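(* Let $n\ge 3$ be an odd integer, let $H_n$ be the edge-colored directed graph on vertex set $\mathbb{Z}_n$ with directed edge set $E=\{(m+i,\,m-i): 0\le m\le n-1,\ 1\le i\le \frac{n-1}{2}\}$ (entries modulo $n$), color set $\{Z_k:k\in\mathbb{Z}_n\}$ and edge-coloring $c(i,j)=Z_{i+j}$ for $(i,j)\in E$. Then the group $\operatorname{GLA}(H_n)$ of graph Lie automorphisms of $H_n$ is isomorphic to the dihedral group $D_n$ of order $2n$. Consequently, the automorphism group $\operatorname{Aut}(\mathcal{N}_{H_n})$ of the 2-step nilpotent Lie algebra $\mathcal{N}_{H_n}$ associated with $H_n$ contains a subgroup isomorphic to the dihedral group of order $2n$.
   Context: An edge-colored directed simple graph $H=(S,E,c:E\to\mathscr{C})$ consists of a finite vertex set $S$, a set $E$ of directed edges $(\alpha,\beta)$ with $\alpha\ne\beta$ in $S$ (for any two vertices at most one of $(\alpha,\beta),(\beta,\alpha)$ is in $E$), a finite set $\mathscr{C}$ of colors and a surjective map $c:E\to\mathscr{C}$; we write $c(\alpha,\beta)$ for the color of $(\alpha,\beta)$. Associated Lie algebra $\mathcal{N}_H$: the underlying real vector space is $V\oplus W$, where $V$ is the real vector space with basis $S$ and $W$ is the real vector space with basis $\mathscr{C}$. The Lie bracket is the bilinear antisymmetric bracket determined by: if $(\alpha,\beta)\in E$ and $c(\alpha,\beta)=Z$ then $[\alpha,\beta]=-[\beta,\alpha]=Z$; if neither $(\alpha,\beta)$ nor $(\beta,\alpha)$ is in $E$ then $[\alpha,\beta]=[\beta,\alpha]=0$;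 and $[Y,Z]=0$ for all $Y\in\mathcal{N}_H$, $Z\in W$. $\operatorname{Aut}(\mathcal{N}_H)$ is the group of linear isomorphisms $\tau:\mathcal{N}_H\to\mathcal{N}_H$ with $\tau[X,Y]=[\tau X,\tau Y]$ for all $X,Y$. Underlying undirected graph: $H_u=(S,E_u,c_u:E_u\to\mathscr{C})$ with $E_u=\{\{\alpha,\beta\}:(\alpha,\beta)\in E\}$ and $c_u(\{\alpha,\beta\})=c(\alpha,\beta)$ if $(\alpha,\beta)\in E$. A color permuting automorphism of $H_u$ is a bijection $\chi:S\to S$ such that $\{\chi(\alpha),\chi(\beta)\}\in E_u\iff\{\alpha,\beta\}\in E_u$ for all $\alpha,\beta\in S$, and for which there is a permutation $\phi$ of $\mathscr{C}$ with $c_u(\{\chi(\alpha),\chi(\beta)\})=\phi(c_u(\{\alpha,\beta\}))$ for every edge $\{\alpha,\beta\}\in E_u$. Let $E^-=\{(\beta,\alpha):(\alpha,\beta)\in E\}$ and $\mathscr{C}^-=\{-Z\in W: Z\in\mathscr{C}\}$, and extend $c$ to $E\cup E^-$ by $c(\beta,\alpha)=-c(\alpha,\beta)$ for $(\alpha,\beta)\in E$. A graph Lie automorphism of $H$ is a color permuting automorphism $\chi$ of $H_u$ for which there exists a permutation $\phi$ of $\mathscr{C}\cup\mathscr{C}^-$ with $c(\chi(\alpha),\chi(\beta))=\phi(c(\alpha,\beta))$ for all $(\alpha,\beta)\in E\cup E^-$. These form a group under composition, denoted $\operatorname{GLA}(H)$. $\mathbb{Z}_n=\{0,\dots,n-1\}$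 is the cyclic group of integers modulo $n$. The underlying undirected graph of $H_n$ is the complete graph on $\mathbb{Z}_n$. *)

(* Defs.v *)
From HB Require Import structures.
From mathcomp Require Import all_boot all_order all_algebra all_fingroup.
From mathcomp Require Import all_solvable.
From mathcomp Require Import boolp reals.
From mathcomp Require Import zify.

Set Implicit Arguments.
Unset Strict Implicit.
Unset Printing Implicit Defensive.

Import GRing.Theory Num.Theory.
Local Open Scope ring_scope.

(* [color H a b] is meaningful only when [edge H a b] holds; every definition
   below reads it on edges only. *)
Record ecdgraph (S C : finType) := ECDGraph {
  edge : rel S;
  color : S -> S -> C;
  edge_irr : irreflexive edge;
  edge_asym : forall a b, edge a b -> ~~ edge b a;
  color_surj : forall z, exists a b, edge a b /\ color a b = z }.

Section UndirectedGraph.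
Variables (S C : finType) (H : ecdgraph S C).

Definition uedge : rel S := fun a b => edge H a b || edge H b a.

Definition ucolor (a b : S) : C :=
  if edge H a b then color H a b else color H b a.

Definition color_permuting (chi : {perm S}) : bool :=
  [forall a, forall b, uedge (chi a) (chi b) == uedge a b] &&
  [exists phi : {perm C}, forall a, forall b,
     uedge a b ==> (ucolor (chi a) (chi b) == phi (ucolor a b))].

(* The set of signed colors [C \cup C^-] is encoded by [bool * C]: the pair
   [(s, Z)] stands for [(-1)^s Z]; see [signed_vec] and [signed_vec_inj]. *)
Definition ext_color (a b : S) : bool * C :=
  if edge H a b then (false, color H a b) else (true, color H b a).

Definition graph_lie_aut (chi : {perm S}) : bool :=
  color_permuting chi &&
  [exists phi : {perm bool * C}, forall a, forall b,
     uedge a b ==> (ext_color (chi a) (chi b) == phi (ext_color a b))].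

Definition GLA : {set {perm S}} := [set chi | graph_lie_aut chi].

Lemma GLA_group_set : group_set GLA.
Proof.
apply/group_setP; split.
  rewrite inE; apply/andP; split; last first.
    by apply/existsP; exists 1%g; do 2!apply/forallP=> ?; rewrite !perm1 eqxx implybT.
  apply/andP; split; first by do 2!apply/forallP=> ?; rewrite !perm1.
  by apply/existsP; exists 1%g; do 2!apply/forallP=> ?; rewrite !perm1 eqxx implybT.
move=> x y; rewrite !inE.
move=> /andP[/andP[/'forall_forallP ex /existsP[px cx]] /existsP[qx sx]].
move=> /andP[/andP[/'forall_forallP ey /existsP[py cy]] /existsP[qy sy]].
move: cx cy sx sy => /'forall_forallP cx /'forall_forallP cy.
move=> /'forall_forallP sx /'forall_forallP sy.
apply/andP; split; last first.
  apply/existsP; exists (qx * qy)%g; apply/'forall_forallP=> a b.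
  apply/implyP=> ab; rewrite !permM.
  have xab : uedge (x a) (x b) by rewrite (eqP (ex a b)).
  by rewrite (eqP (implyP (sy _ _) xab)) (eqP (implyP (sx _ _) ab)).
apply/andP; split.
  by apply/'forall_forallP=> a b; rewrite !permM (eqP (ey _ _)) (eqP (ex _ _)).
apply/existsP; exists (px * py)%g; apply/'forall_forallP=> a b.
apply/implyP=> ab; rewrite !permM.
have xab : uedge (x a) (x b) by rewrite (eqP (ex a b)).
by rewrite (eqP (implyP (cy _ _) xab)) (eqP (implyP (cx _ _) ab)).
Qed.

Canonical GLA_group := Group GLA_group_set.

End UndirectedGraph.

Section LieAlgebra.
Variables (R : realType) (S C : finType) (H : ecdgraph S C).

(* [V \oplus W], with [V] and [W] the spaces of real functions on the finite
   bases [S] and [C]. *)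
Definition nilLie : vectType R := ({ffun S -> R^o} * {ffun C -> R^o})%type.

Definition signed_vec (z : bool * C) : {ffun C -> R^o} :=
  [ffun k => (-1) ^+ z.1 * (k == z.2)%:R].

Lemma signed_vec_inj : injective signed_vec.
Proof.
move=> [s x] [t y] /ffunP /(_ x); rewrite !ffunE /= eqxx.
have [->|_] := eqVneq x y; last by move/eqP; rewrite mulr1 mulr0 signr_eq0.
by rewrite !mulr1 => /eqP; rewrite (inj_eq signr_inj) => /eqP ->.
Qed.

Definition basis_br (a b : S) : {ffun C -> R^o} :=
  if uedge H a b then signed_vec (ext_color H a b) else 0.

Definition lie_br (x y : nilLie) : nilLie :=
  (0, \sum_(a : S) \sum_(b : S) (x.1 a * y.1 b) *: basis_br a b).

Definition vvec (a : S) : nilLie := ([ffun b => (b == a)%:R], 0).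
Definition wvec (z : C) : nilLie := (0, signed_vec (false, z)).

Lemma lie_br_vvec a b : lie_br (vvec a) (vvec b) = (0, basis_br a b).
Proof.
congr (_, _); rewrite (bigD1 a) //= (bigD1 b) //= !ffunE !eqxx mulr1 scale1r.
rewrite !big1 ?addr0 // => i /negPf ni.
  by rewrite big1 // => j _; rewrite !ffunE ni mul0r scale0r.
by rewrite !ffunE ni mulr0 scale0r.
Qed.

Lemma lie_br_edge a b : edge H a b ->
  lie_br (vvec a) (vvec b) = wvec (color H a b).
Proof. by move=> ab; rewrite lie_br_vvec /basis_br /uedge /ext_color ab. Qed.

Lemma lie_br_nonedge a b : ~~ uedge H a b -> lie_br (vvec a) (vvec b) = 0.
Proof. by move=> /negPf ab; rewrite lie_br_vvec /basis_br ab. Qed.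

Lemma lie_br_central x (w : {ffun C -> R^o}) : lie_br x (0, w) = 0.
Proof.
congr (_, _); rewrite big1 // => a _; rewrite big1 // => b _.
by rewrite ffunE mulr0 scale0r.
Qed.

Lemma lie_brC x y : lie_br x y = - lie_br y x.
Proof.
rewrite /lie_br; apply/eqP; rewrite xpair_eqE oppr0 eqxx /=; apply/eqP.
rewrite exchange_big -sumrN; apply: eq_bigr => b _.
rewrite -sumrN; apply: eq_bigr => a _; rewrite mulrC -scalerN; congr (_ *: _).
rewrite /basis_br /uedge orbC; case: ifP; last by rewrite oppr0.
rewrite /ext_color => /orP[ba|ab].
  rewrite ba (negPf (edge_asym ba)); apply/ffunP=> k.
  by rewrite !ffunE expr0 expr1 mul1r mulN1r.
rewrite ab (negPf (edge_asym ab)); apply/ffunP=> k.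
by rewrite !ffunE expr0 expr1 mul1r mulN1r opprK.
Qed.

Lemma lie_br_linear x : linear (lie_br x).
Proof.
move=> k y z; apply/eqP; rewrite xpair_eqE /= scaler0 addr0 eqxx /=; apply/eqP.
rewrite scaler_sumr -big_split; apply: eq_bigr => a _ /=.
rewrite scaler_sumr -big_split; apply: eq_bigr => b _ /=.
by rewrite !ffunE scalerA -scalerDl mulrDr !(mulrCA _ k).
Qed.

Definition is_lie_aut (f : 'End(nilLie)) : Prop :=
  bijective f /\ forall x y, f (lie_br x y) = lie_br (f x) (f y).

Record lie_aut := LieAut {
  lie_aut_fun :> 'End(nilLie);
  lie_aut_fun_subproof : `[< is_lie_aut lie_aut_fun >] }.

HB.instance Definition _ := [isSub for lie_aut_fun].
HB.instance Definition _ := [Choice of lie_aut by <:].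

Lemma lie_autP (f : lie_aut) : is_lie_aut f.
Proof. exact/asboolP/lie_aut_fun_subproof. Qed.

Lemma lie_aut_lker (f : lie_aut) : lker f == 0%VS.
Proof. by apply/lker0P/bij_inj; case: (lie_autP f). Qed.

Fact lie_aut_one_subproof : `[< is_lie_aut \1%VF >].
Proof.
apply/asboolP; split; last by move=> x y; rewrite !id_lfunE.
by exists id => x; rewrite id_lfunE.
Qed.

Fact lie_aut_mul_subproof (f g : lie_aut) : `[< is_lie_aut (f \o g)%VF >].
Proof.
have [bf mf] := lie_autP f; have [bg mg] := lie_autP g.
apply/asboolP; split; last by move=> x y; rewrite !comp_lfunE mg mf.
by apply: (eq_bij (bij_comp bf bg)) => x; rewrite comp_lfunE.
Qed.

Fact lie_aut_inv_subproof (f : lie_aut) : `[< is_lie_aut (f^-1)%VF >].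
Proof.
have [bf mf] := lie_autP f; have kf := lie_aut_lker f.
apply/asboolP; split.
  by exists f; [apply: lker0_lfunVK | apply: lker0_lfunK].
move=> x y; apply: (bij_inj bf).
by rewrite mf !lker0_lfunVK.
Qed.

Definition lie_aut_one := LieAut lie_aut_one_subproof.
Definition lie_aut_mul f g := LieAut (lie_aut_mul_subproof f g).
Definition lie_aut_inv f := LieAut (lie_aut_inv_subproof f).

Fact lie_aut_mulA : associative lie_aut_mul.
Proof. by move=> f g h; apply/val_inj/comp_lfunA. Qed.
Fact lie_aut_mul1 : left_id lie_aut_one lie_aut_mul.
Proof. by move=> f; apply/val_inj/comp_lfun1l. Qed.
Fact lie_aut_mulr1 : right_id lie_aut_one lie_aut_mul.
Proof. by move=> f; apply/val_inj/comp_lfun1r. Qed.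
Fact lie_aut_mulV : left_inverse lie_aut_one lie_aut_inv lie_aut_mul.
Proof. by move=> f; apply/val_inj/lker0_compVf/lie_aut_lker. Qed.
Fact lie_aut_mulrV : right_inverse lie_aut_one lie_aut_inv lie_aut_mul.
Proof. by move=> f; apply/val_inj/lker0_compfV/lie_aut_lker. Qed.

HB.instance Definition _ := isGroup.Build lie_aut
  lie_aut_mulA lie_aut_mul1 lie_aut_mulr1 lie_aut_mulV lie_aut_mulrV.

End LieAlgebra.

Definition contains_subgroup_isomorphic_to (A G : groupType) : Prop :=
  exists2 K : {pred A}, group_closed K &
  exists f : G -> A, [/\ {morph f : x y / (x * y)%g}, injective f
    & forall y, y \in K <-> exists x, f x = y].

Section Hn.
Variables (n : nat) (n_ge3 : (3 <= n)%N) (n_odd : odd n).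

Definition Hn_edge : rel 'Z_n := fun a b =>
  [exists m : 'Z_n, exists i : 'I_n,
    [&& (1 <= i <= (n - 1)./2)%N, a == m + i%:R & b == m - i%:R]].

Definition Hn_color (a b : 'Z_n) : 'Z_n := a + b.

Lemma Zn_half (x y : 'Z_n) : x + x = y + y -> x = y.
Proof.
have n_gt1 : (1 < n)%N by apply: ltnW.
have h2 : (2 * n.+1./2)%:R = 1 :> 'Z_n.
  have -> : (2 * n.+1./2 = n.+1)%N.
    by rewrite mul2n; have := odd_double_half n.+1; rewrite /= n_odd.
  by rewrite -natr1 pchar_Zp // add0r.
rewrite -!mulr2n -(mulr_natl x) -(mulr_natl y) => /(congr1 ( *%R (n.+1./2)%:R)).
by rewrite !mulrA -!natrM mulnC h2 !mul1r.
Qed.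

Fact Hn_asym a b : Hn_edge a b -> ~~ Hn_edge b a.
Proof.
move=> /existsP[m /existsP[i /and3P[hi /eqP-> /eqP->]]].
apply/negP=> /existsP[m' /existsP[j /and3P[hj /eqP e1 /eqP e2]]].
have n_gt1 : (1 < n)%N by apply: ltnW.
have em : m = m'.
  apply: Zn_half; have : (m - i%:R) + (m + i%:R) = (m' + j%:R) + (m' - j%:R).
    by rewrite e1 e2.
  by rewrite !(addrACA _ _ m) !(addrACA _ _ m') addNr !subrr !addr0.
move: e2; rewrite em => /addrI /eqP.
rewrite -subr_eq0 opprK -natrD => /eqP /(congr1 val) /=.
rewrite val_Zp_nat // => h0.
by have : (i + j < n)%N; [lia | move=> lt; rewrite modn_small // in h0; lia].
Qed.

Fact Hn_irr : irreflexive Hn_edge.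
Proof. by move=> a; case aa: (Hn_edge a a) => //; move: (Hn_asym aa); rewrite aa. Qed.

Fact Hn_surj z : exists a b, Hn_edge a b /\ Hn_color a b = z.
Proof.
have n_gt1 : (1 < n)%N by apply: ltnW.
pose m : 'Z_n := (n.+1./2)%:R * z.
exists (m + 1), (m - 1); split.
  apply/existsP; exists m; apply/existsP; exists (Ordinal n_gt1).
  by rewrite /= !eqxx !andbT; lia.
rewrite /Hn_color addrACA subrr addr0; apply: Zn_half.
rewrite -mulr2n -mulr_natl /m mulrA -natrM.
have -> : (2 * n.+1./2 = n.+1)%N.
  by rewrite mul2n; have := odd_double_half n.+1; rewrite /= n_odd.
by rewrite -natr1 pchar_Zp // add0r mul1r.
Qed.

Definition Hn : ecdgraph 'Z_n 'Z_n :=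
  @ECDGraph _ _ Hn_edge Hn_color Hn_irr Hn_asym Hn_surj.

End Hn.

(* Main.v *)
From HB Require Import structures.
Require Import Defs.
From mathcomp Require Import all_boot all_order all_algebra all_fingroup.
From mathcomp Require Import all_solvable.
From mathcomp Require Import boolp reals zify ring.

(** A color permuting automorphism [chi] of the complete graph on Z_n satisfies
    [chi a + chi b = phi (a + b)] for all [a <> b], with [phi] the induced
    permutation of the colors.  The color class of [m + m] is a perfect matching
    of the vertices other than [m], so the vertices missed by two corresponding
    classes correspond, and the identity extends to [a = b].  Hence
    [chi a + chi b = chi (a + b) + chi 0] ([GLA_add]), that is, [chi] is an
    affine map [x |-> x * u + chi 0].

    The orientation then pins down [u].  The edge inside [{m + d, m - d}] starts
    at [m + d] exactly when [d] lies in [P = {1, .., (n - 1) / 2}].  All edges of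
    one color have to keep, or all have to reverse, their direction; applied to
    the color [0] this says that multiplication by [u] or by [- u] maps [P] into
    [P], which forces that multiplier to be [1] ([stable_first_half]).
    Conversely every map [x |-> c + x] or [x |-> c - x] is a graph Lie
    automorphism ([affine_GLA]).  These [2n] maps satisfy the dihedral relations
    and are generated by [x |-> x + 1] and [x |-> - x].

    The second claim holds for every edge-colored directed graph [H]: [GLA H]
    acts faithfully on the Lie algebra of [H], by permuting the vertex
    coordinates and, up to sign, the color coordinates ([GLA_lieM],
    [GLA_lie_inj]). *)

Set Implicit Arguments.
Unset Strict Implicit.
Unset Printing Implicit Defensive.

Import GRing.Theory.

(** * The permutation of signed colors induced by a graph Lie automorphism *)

Section SignedColors.
Local Open Scope ring_scope.
Variables (S C : finType) (H : ecdgraph S C).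

Definition neg_color (p : bool * C) : bool * C := (~~ p.1, p.2).

Lemma uedge_sym a b : uedge H a b = uedge H b a.
Proof. exact: orbC. Qed.

Lemma ext_colorC a b :
  uedge H a b -> ext_color H b a = neg_color (ext_color H a b).
Proof.
by rewrite /ext_color => /orP[] ab; rewrite ab (negPf (edge_asym ab)).
Qed.

Lemma ext_color_surj p : exists a b, uedge H a b /\ ext_color H a b = p.
Proof.
case: p => s z; have [a [b [ab <-]]] := color_surj H z.
have ua : uedge H a b by rewrite /uedge ab.
have ea : ext_color H a b = (false, color H a b) by rewrite /ext_color ab.
case: s; last by exists a, b.
by exists b, a; rewrite uedge_sym ua ext_colorC // ea.
Qed.

Definition induces (chi : {perm S}) (phi : {perm bool * C}) :=
  [forall a, forall b,
     uedge H a b ==> (ext_color H (chi a) (chi b) == phi (ext_color H a b))].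

Lemma inducesP (chi : {perm S}) (phi : {perm bool * C}) : reflect
  (forall a b, uedge H a b ->
     ext_color H (chi a) (chi b) = phi (ext_color H a b)) (induces chi phi).
Proof.
apply: (iffP 'forall_forallP) => h a b; first by move=> ab; apply/eqP/(implyP (h a b)).
by apply/implyP => ab; apply/eqP/h.
Qed.

(** Surjectivity of the coloring leaves no freedom in the permutation of signed
    colors; its dependence on the automorphism is therefore multiplicative. *)
Lemma induces_unique chi phi psi : induces chi phi -> induces chi psi -> phi = psi.
Proof.
move=> /inducesP hphi /inducesP hpsi; apply/permP => p.
have [a [b [ab <-]]] := ext_color_surj p.
by rewrite -hphi // hpsi.
Qed.

(** The default value is only reached outside of [GLA H]. *)
Definition color_perm (chi : {perm S}) : {perm bool * C} :=
  odflt 1%g [pick phi | induces chi phi].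

Lemma GLA_uedge chi a b : chi \in GLA H -> uedge H (chi a) (chi b) = uedge H a b.
Proof. by rewrite inE => /andP[/andP[/'forall_forallP h _] _]; apply/eqP/h. Qed.

Lemma color_permP chi : chi \in GLA H -> induces chi (color_perm chi).
Proof.
rewrite inE => /andP[_ /existsP[phi hphi]].
by rewrite /color_perm; case: pickP => [//|/(_ phi)]; rewrite /induces hphi.
Qed.

Lemma color_permM : {in GLA H &, {morph color_perm : x y / (x * y)%g}}.
Proof.
move=> x y Hx Hy; apply: (@induces_unique (x * y)%g).
  exact/color_permP/(@groupM _ (GLA_group H)).
apply/inducesP => a b ab; rewrite !permM.
rewrite (inducesP _ _ (color_permP Hy)) ?GLA_uedge //.
by rewrite (inducesP _ _ (color_permP Hx)).
Qed.

(** Reversing an edge negates its signed color, and every signed color is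
    attained: this is why the induced permutation commutes with negation, and
    hence extends linearly to the span of the colors. *)
Lemma color_permN chi p : chi \in GLA H ->
  color_perm chi (neg_color p) = neg_color (color_perm chi p).
Proof.
move=> Hchi; have /inducesP h := color_permP Hchi.
have [a [b [ab <-]]] := ext_color_surj p.
by rewrite -ext_colorC // -h 1?uedge_sym // -h // ext_colorC // GLA_uedge.
Qed.

End SignedColors.

(** * The action on the Lie algebra *)

Section LieAction.
Local Open Scope ring_scope.
Variables (R : realType) (S C : finType) (H : ecdgraph S C).
Local Notation N := (nilLie R S C).

(** The coordinate of [w] at a signed color: the linear form dual to
    [signed_vec R p]. *)
Definition eval_color (p : bool * C) (w : {ffun C -> R^o}) : R^o :=
  (-1) ^+ p.1 * w p.2.

Fact eval_color_is_linear p : scalar (eval_color p).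
Proof. by move=> c u v; rewrite /eval_color !ffunE mulrDr mulrCA. Qed.

HB.instance Definition _ p :=
  GRing.isLinear.Build R _ R^o _ (eval_color p) (eval_color_is_linear p).

Lemma eval_colorN p w : eval_color (neg_color p) w = - eval_color p w.
Proof. by rewrite /eval_color signrN mulNr. Qed.

Lemma eval_signed_vec (q p : bool * C) :
  eval_color p (signed_vec R q) = (p == q)%:R - (p == neg_color q)%:R.
Proof.
case: p q => [s y] [t z]; rewrite /eval_color ffunE !xpair_eqE /=.
by case: (y == z); case: s; case: t;
  rewrite /= ?expr0 ?expr1 ?mulr0 ?mulr1 ?subr0 ?sub0r ?oppr0 ?mulrNN ?mul1r.
Qed.

(** Acting by precomposition makes [lie_act] a homomorphism: permutations
    compose from left to right, linear maps from right to left. *)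
Definition lie_act (chi : {perm S}) (x : N) : N :=
  ([ffun a => x.1 (chi a)],
   [ffun k => eval_color (color_perm H chi (false, k)) x.2]).

Fact lie_act_is_linear chi : linear (lie_act chi).
Proof.
move=> k x y; congr (_, _); apply/ffunP => i; rewrite !ffunE //.
by rewrite linearP.
Qed.

HB.instance Definition _ chi := GRing.isLinear.Build R N N *:%R (lie_act chi)
  (lie_act_is_linear chi).

Lemma eval_lie_act chi x p : chi \in GLA H ->
  eval_color p (lie_act chi x).2 = eval_color (color_perm H chi p) x.2.
Proof.
move=> Hchi; case: p => [[] k]; rewrite {1}/eval_color ffunE /= ?mul1r //.
by rewrite -[(true, k)]/(neg_color (false, k)) color_permN // eval_colorN mulN1r.
Qed.

Lemma lie_actM chi psi x : chi \in GLA H -> psi \in GLA H ->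
  lie_act (chi * psi)%g x = lie_act chi (lie_act psi x).
Proof.
move=> Hchi Hpsi; congr (_, _); apply/ffunP => i; first by rewrite !ffunE permM.
by rewrite !ffunE eval_lie_act // color_permM // permM.
Qed.

Lemma lie_act1 x : lie_act 1%g x = x.
Proof.
have s1 : color_perm H 1 = 1%g.
  apply: (@induces_unique _ _ H 1%g); first exact/color_permP/(group1 (GLA_group H)).
  by apply/inducesP => a b _; rewrite !perm1.
case: x => v w; congr (_, _); apply/ffunP => i; rewrite !ffunE ?s1 perm1 //.
by rewrite /eval_color /= mul1r.
Qed.

(** After reindexing both sums along [chi], the claim reduces to pairs of basis
    vertices, where the pairing of two signed colors is invariant under a
    permutation that commutes with negation. *)
Lemma lie_act_br chi x y : chi \in GLA H ->
  lie_act chi (lie_br H x y) = lie_br H (lie_act chi x) (lie_act chi y).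
Proof.
move=> Hchi; congr (_, _); apply/ffunP => k; rewrite !ffunE //=.
rewrite linear_sum (reindex_inj (@perm_inj _ chi)) sum_ffunE.
apply: eq_bigr => a _.
rewrite linear_sum (reindex_inj (@perm_inj _ chi)) sum_ffunE.
apply: eq_bigr => b _; rewrite linearZ !ffunE /=; congr (_ * _).
rewrite /basis_br GLA_uedge //; case: ifP => ab; last by rewrite /eval_color !ffunE mulr0.
rewrite (inducesP _ _ _ (color_permP Hchi)) //.
rewrite eval_signed_vec -color_permN // !(inj_eq perm_inj) -eval_signed_vec.
by rewrite /eval_color mul1r.
Qed.

Definition lie_act_lfun chi : 'End(N) := linfun (lie_act chi).

Fact lie_act_aut chi : chi \in GLA H -> is_lie_aut H (lie_act_lfun chi).
Proof.
move=> Hchi; split; last by move=> x y; rewrite !lfunE /= lie_act_br.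
have HV : (chi^-1)%g \in GLA H by rewrite (@groupV _ (GLA_group H)).
by exists (lie_act chi^-1) => x; rewrite lfunE /= -lie_actM // ?mulVg ?mulgV lie_act1.
Qed.

(** Made total, with irrelevant values outside of [GLA H], so that it can be
    composed with a group morphism without carrying membership proofs. *)
Definition GLA_lie chi : lie_aut R H := insubd (lie_aut_one R H) (lie_act_lfun chi).

Lemma GLA_lieE chi x : chi \in GLA H -> GLA_lie chi x = lie_act chi x.
Proof.
move=> Hchi; rewrite -[lie_aut_fun _]/(val _) insubdK; first exact: lfunE.
exact/asboolP/lie_act_aut.
Qed.

Lemma GLA_lieM : {in GLA H &, {morph GLA_lie : x y / (x * y)%g}}.
Proof.
move=> x y Hx Hy; apply/val_inj/lfunP => v /=; rewrite comp_lfunE !GLA_lieE ?lie_actM //.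
exact: (@groupM _ (GLA_group H)).
Qed.

(** The action permutes the basis vectors that come from the vertices, so [chi]
    can be read off their images. *)
Lemma GLA_lie_inj : {in GLA H &, injective GLA_lie}.
Proof.
move=> x y Hx Hy exy; apply/permP => a.
have: lie_act x (vvec R C (x a)) = lie_act y (vvec R C (x a)).
  by rewrite -!GLA_lieE // exy.
case=> /ffunP/(_ a) + _; rewrite !ffunE eqxx.
by have [->//|_ /eqP] := eqVneq (y a) (x a); rewrite oner_eq0.
Qed.

Lemma lie_aut_contains_GLA (gT : finGroupType) :
  GLA H \isog [set: gT] -> contains_subgroup_isomorphic_to (lie_aut R H) gT.
Proof.
rewrite isog_sym => /isogP[g /injmP g_inj im_g].
have gH x : g x \in GLA H by rewrite -im_g mem_morphim ?inE.
pose f x := GLA_lie (g x).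
have fM : {morph f : x y / (x * y)%g}.
  by move=> x y; rewrite /f morphM ?inE // GLA_lieM.
have f1 : f 1%g = 1%g by apply: (@mulgI _ (f 1%g)); rewrite -fM !mulg1.
have fV x : f (x^-1)%g = ((f x)^-1)%g.
  by apply: (@mulgI _ (f x)); rewrite -fM !mulgV.
exists (fun y => `[< exists x, f x = y >]).
  split; first by apply/asboolP; exists 1%g.
  move=> _ _ /asboolP[x <-] /asboolP[y <-]; apply/asboolP.
  by exists (x * y^-1)%g; rewrite fM fV.
exists f; split=> [//| |y]; last by split=> /asboolP.
move=> x y /GLA_lie_inj e; apply: g_inj; rewrite ?inE //; exact: e.
Qed.

End LieAction.

(** * The graph on Z_n *)

Section SymmetriesOfHn.
Local Open Scope ring_scope.
Variables (n : nat) (n_ge3 : (3 <= n)%N) (n_odd : odd n).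
Local Notation H := (Hn n_ge3 n_odd).
Local Notation h := ((n - 1)./2).

Definition first_half (d : 'Z_n) : bool := (1 <= d <= h)%N.

Let n_gt1 : (1 < n)%N. Proof. exact: ltnW. Qed.

Lemma val_Zn_lt (d : 'Z_n) : (d < n)%N.
Proof. by rewrite -[X in (_ < X)%N](Zp_cast n_gt1). Qed.

Lemma first_halfN d : first_half (- d) = (d != 0) && ~~ first_half d.
Proof.
have dn := val_Zn_lt d; rewrite /first_half /= -val_eqE /=.
move: (nat_of_ord d) dn => {}d dn; rewrite (Zp_cast n_gt1).
have [->|d0] := eqVneq d 0%N; first by rewrite subn0 modnn.
by rewrite modn_small; lia.
Qed.

(** As [2] is invertible, a pair of vertices is the same as a midpoint and a
    half-difference; in these coordinates the color is [m + m] and the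
    orientation depends on [d] only. *)
Lemma Zn_midpoint (a b : 'Z_n) : exists m d, a = m + d /\ b = m - d.
Proof.
have h2 : (n.+1./2)%:R + (n.+1./2)%:R = 1 :> 'Z_n.
  rewrite -natrD addnn; have -> : ((n.+1)./2.*2 = n.+1)%N by lia.
  by rewrite -natr1 pchar_Zp // add0r.
set t := (n.+1./2)%:R in h2 *; exists (t * (a + b)), (t * (a - b)).
split; rewrite -[LHS]mul1r -h2; ring.
Qed.

Lemma HnE m d : edge H (m + d) (m - d) = first_half d.
Proof.
apply/existsP/idP => [[m' /existsP[i /and3P[hi /eqP e1 /eqP e2]]]|sd].
  have em : m = m'.
    apply: (Zn_half n_ge3 n_odd).
    have : (m + d) + (m - d) = (m' + i%:R) + (m' - i%:R) by rewrite e1 e2.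
    by rewrite !addrA !(addrAC _ _ m) !(addrAC _ _ m') !addrK.
  move: e1; rewrite em => /addrI ->.
  by rewrite /first_half val_Zp_nat // modn_small.
exists m; apply/existsP; exists (Ordinal (val_Zn_lt d)).
by rewrite /= natr_Zp !eqxx !andbT.
Qed.

Lemma HnEC m d : edge H (m - d) (m + d) = first_half (- d).
Proof. by rewrite -(HnE m) opprK. Qed.

Lemma Hn_uedge a b : uedge H a b = (a != b).
Proof.
have [m [d [-> ->]]] := Zn_midpoint a b.
rewrite /uedge HnE HnEC first_halfN.
have -> : (m + d == m - d) = (d == 0).
  rewrite (inj_eq (addrI m)); apply/eqP/eqP => [e|->]; last by rewrite oppr0.
  by apply: (Zn_half n_ge3 n_odd); rewrite {1}e addNr addr0.
have [->|_] := eqVneq d 0; first by rewrite /first_half.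
by case: (first_half d).
Qed.

Lemma Hn_ext_color m d :
  ext_color H (m + d) (m - d) = (~~ first_half d, m + m).
Proof.
rewrite /ext_color HnE /= /Hn_color.
have e : m + d + (m - d) = m + m by rewrite addrA (addrAC _ _ m) addrK.
by rewrite [m - d + _]addrC e; case: (first_half d).
Qed.

Lemma Hn_ucolor a b : ucolor H a b = a + b.
Proof. by rewrite /ucolor /= /Hn_color [b + a]addrC if_same. Qed.

(** * Reflections and translations are graph Lie automorphisms *)

Definition affine_fun (s : bool) (c x : 'Z_n) : 'Z_n := (if s then - x else x) + c.

Fact affine_inj s c : injective (affine_fun s c).
Proof. by move=> x y /addIr; case: s => // /oppr_inj. Qed.

Definition affine s c : {perm 'Z_n} := perm (@affine_inj s c).

Lemma affineE s c x : affine s c x = (if s then - x else x) + c.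
Proof. by rewrite permE. Qed.

Lemma affineM s c t e :
  (affine s c * affine t e)%g = affine (s (+) t) ((if t then - c else c) + e).
Proof.
apply/permP => x; rewrite permM !affineE.
by case: s; case: t; rewrite /= addrA ?opprD ?opprK.
Qed.

Lemma affine1 : affine false 0 = 1%g.
Proof. by apply/permP => x; rewrite affineE perm1 addr0. Qed.

Lemma affineX c k : (affine false c ^+ k)%g = affine false (c *+ k).
Proof.
elim: k => [|k IH]; first by rewrite expg0 mulr0n affine1.
by rewrite expgS IH affineM mulrS.
Qed.

Fact signed_affine_inj s c :
  injective (fun p : bool * 'Z_n => (s (+) p.1, affine s c p.2)).
Proof. by move=> [t x] [u y] [/addbI -> /perm_inj ->]. Qed.

(** The color of an edge is the sum of its ends, so it is moved by
    [affine s (c + c)]; the sign is flipped exactly when the half-differences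
    are negated. *)
Lemma affine_GLA s c : affine s c \in GLA H.
Proof.
rewrite inE; apply/andP; split; [apply/andP; split|].
- by apply/'forall_forallP => a b; rewrite !Hn_uedge (inj_eq perm_inj).
- apply/existsP; exists (affine s (c + c)); apply/'forall_forallP => a b.
  rewrite !Hn_ucolor !affineE; apply/implyP => _; apply/eqP.
  by rewrite addrACA; case: s; rewrite ?opprD.
apply/existsP; exists (perm (@signed_affine_inj s (c + c))).
apply/'forall_forallP => a b; apply/implyP; have [m [d [-> ->]]] := Zn_midpoint a b.
rewrite Hn_uedge => ab; apply/eqP; rewrite [RHS]permE Hn_ext_color !affineE.
case: s => /=.
  have -> : - (m + d) + c = (- m + c) + (- d) by ring.
  have -> : - (m - d) + c = (- m + c) - (- d) by ring.
  rewrite Hn_ext_color first_halfN negbK addrACA opprD.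
  have -> : d != 0 by apply: contraNneq ab => ->; rewrite oppr0.
  by rewrite negbK.
by rewrite [m + d + c]addrAC [m - d + c]addrAC Hn_ext_color addrACA.
Qed.

(** * Graph Lie automorphisms are reflections or translations *)

(** For the case [a = b]: were [chi y + chi y] different from [phi (y + y)], the
    partner [chi z] of [chi y] in the color class [phi (y + y)] would make the
    edge [{z, y}] have the color [y + y], which no edge at [y] has. *)
Lemma GLA_add chi a b : chi \in GLA H ->
  chi a + chi b = chi (a + b) + chi 0.
Proof.
rewrite inE => /andP[/andP[_ /existsP[phi /'forall_forallP hphi]] _].
have hne x y : x != y -> chi x + chi y = phi (x + y).
  by move=> xy; have := hphi x y; rewrite Hn_uedge xy !Hn_ucolor => /eqP.
have hall x y : chi x + chi y = phi (x + y).
  have [->|/hne//] := eqVneq x y.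
  (* [chi z] is the partner of [chi y] in the color class [phi (y + y)]. *)
  set z := (chi^-1)%g (phi (y + y) - chi y).
  have ez : chi z + chi y = phi (y + y) by rewrite /z permKV subrK.
  have [zy|zy] := eqVneq z y; first by move: ez; rewrite zy.
  by move: (hne z y zy); rewrite ez => /perm_inj/addIr e; rewrite e eqxx in zy.
by rewrite !hall addr0.
Qed.

(** As [1] lies in the first half, so does [u]; then the multiples of [u] never
    leave [{1, .., h}], without ever wrapping around modulo [n] since one step
    adds at most [h].  The [h]-th of them is at most [h] only if [u = 1]. *)
Lemma stable_first_half (u : 'Z_n) :
  (forall d, first_half d -> first_half (d * u)) -> u = 1.
Proof.
move=> hu.
have val1 : (1 : 'Z_n) = 1%N :> nat by rewrite /= modn_small // Zp_cast.
have su : first_half u by rewrite -[u]mul1r; apply: hu; rewrite /first_half val1; lia.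
have [e|u1] := eqVneq (u : nat) 1%N; first exact/ord_inj/(etrans e (esym val1)).
have mulE k : (k * u < n)%N -> ((k%:R : 'Z_n) * u) = (k * u)%N :> nat.
  by move=> lt; rewrite -[in LHS](natr_Zp u) -natrM val_Zp_nat // modn_small.
have leE k : (k <= h)%N -> (k * u <= h)%N.
  elim: k => // k IH kh.
  have {}IH := IH (ltnW kh).
  have : first_half (k.+1%:R * u).
    by apply: hu; rewrite /first_half val_Zp_nat // modn_small; lia.
  have lt : (k.+1 * u < n)%N by move: su; rewrite mulSn /first_half; lia.
  by rewrite /first_half mulE // => /andP[].
have := leE h (leqnn _).
move: su u1; rewrite /first_half; nia.
Qed.

Lemma GLA_affine chi : chi \in GLA H -> exists s, chi = affine s (chi 0).
Proof.
move=> Hchi; have hadd a b := GLA_add a b Hchi.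
pose u := chi 1 - chi 0.
have chiE x : chi x = x * u + chi 0.
  rewrite -[x]natr_Zp; elim: (x : nat) => [|k IH]; first by rewrite mul0r add0r.
  apply: (addIr (chi 0)); rewrite -[k.+1]addn1 natrD -hadd IH /u; ring.
move: (Hchi); rewrite inE => /andP[_ /existsP[phi /'forall_forallP hphi]].
have u0 d : d != 0 -> d * u != 0.
  move=> d0; apply: contra_neq d0 => e; apply: (@perm_inj _ chi).
  by rewrite chiE e add0r.
have small0 d : first_half d -> d != 0 by apply: contraTneq => ->.
(* The edges of color [0] are the [(d, - d)] with [d] in the first half; [s]
   records whether they are reversed. *)
pose s := (phi (false, 0)).1.
have hs d : first_half d -> first_half (d * u) = ~~ s.
  move=> sd; have ne : 0 + d != 0 - d.
    by apply/eqP => e; have := HnE 0 d; rewrite -e (edge_irr H) sd.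
  have := hphi (0 + d) (0 - d); rewrite Hn_uedge ne implyTb Hn_ext_color sd addr0.
  rewrite (chiE (0 + d)) (chiE (0 - d)) mulrDl mulrBl mul0r add0r sub0r.
  rewrite [d * u + _]addrC [- _ + _]addrC Hn_ext_color => /eqP.
  by rewrite /s => <-; rewrite negbK.
exists s; apply/permP => x; rewrite affineE chiE; congr (_ + _).
case: s hs => hs.
  have /(congr1 -%R) : - u = 1.
    by apply: stable_first_half => d sd; rewrite mulrN first_halfN hs // u0 ?small0.
  by rewrite opprK => ->; rewrite mulrN1.
by rewrite (@stable_first_half u) ?mulr1 // => d sd; rewrite hs.
Qed.

Lemma GLA_Hn_affine : GLA H = [set affine p.1 p.2 | p : bool * 'Z_n].
Proof.
apply/setP => chi; apply/idP/imsetP => [/GLA_affine[s e]|[p _ ->]].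
  by exists (s, chi 0).
exact: affine_GLA.
Qed.

Lemma affine_uncurry_inj : injective (fun p : bool * 'Z_n => affine p.1 p.2).
Proof.
move=> [s c] [t e] /= /permP E.
have ce : c = e by have := E 0; rewrite !affineE oppr0 !if_same !add0r.
move: (E 1); rewrite !affineE ce => /addIr {E}.
have n1 : (- 1 != 1 :> 'Z_n).
  apply/eqP => /(congr1 (fun x => x + 1)); rewrite addNr => /(congr1 val) /=.
  by rewrite !modn_small ?Zp_cast // modn_small // Zp_cast; lia.
by case: s; case: t => // /eqP; rewrite 1?[1 == _]eq_sym (negPf n1).
Qed.

Lemma card_GLA_Hn : #|GLA H| = n.*2.
Proof.
rewrite GLA_Hn_affine (card_imset _ affine_uncurry_inj).
by rewrite card_prod card_bool card_ord Zp_cast // mul2n.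
Qed.

(** * The dihedral group *)

Lemma GLA_Hn_dihedral : GLA H \isog [set: 'D_(2 * n)].
Proof.
rewrite mul2n -[GLA H]/(gval (GLA_group H)).
apply/(isoGrpP _ (Grp_dihedral n_gt1)).
split; first by rewrite card_dihedral //= card_GLA_Hn.
apply/existsP; exists (affine false 1, affine true 0) => /=.
rewrite !xpair_eqE /=; apply/and4P; split.
- rewrite eqEsubset join_subG !cycle_subG !affine_GLA /=.
  apply/subsetP => chi /GLA_affine[s ->].
  have -> : affine s (chi 0) =
      (affine true 0%R ^+ s * affine false 1%R ^+ (chi 0 : nat))%g.
    rewrite affineX natr_Zp; case: s; rewrite ?expg1 ?expg0 ?mul1g //.
    by rewrite affineM addbF add0r.
  by rewrite groupM // groupX // mem_gen // inE cycle_id ?orbT.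
- by rewrite affineX pchar_Zp // affine1.
- by rewrite expgS expg1 affineM oppr0 addr0 affine1.
- rewrite conjgE; apply/eqP/(mulgI (affine true 0)); rewrite mulKVg.
  apply: (mulIg (affine false 1)); rewrite mulgKV.
  by rewrite !affineM addr0 addNr.
Qed.

End SymmetriesOfHn.

Theorem theorem1p2 (R : realType) (n : nat) (n_ge3 : (3 <= n)%N)
    (n_odd : odd n) :
  GLA (Hn n_ge3 n_odd) \isog ('D_(2 * n))%g /\
  contains_subgroup_isomorphic_to
    (lie_aut R (Hn n_ge3 n_odd)) ('D_(2 * n))%type.
Proof.
split; first exact: GLA_Hn_dihedral.
exact/lie_aut_contains_GLA/GLA_Hn_dihedral.
Qed.
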